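(* Let $\pi$ be a probability distribution on $(\mathsf{X},\mathscr{X})$ and $T_{1},T_{-1}$ sub-stochastic kernels with $\pi({\rm d}x)T_{1}(x,{\rm d}y)=\pi({\rm d}y)T_{-1}(y,{\rm d}x)$. Let $E=\mathsf{X}\times\{-1,1\}$, $\mu({\rm d}(x,v))=\tfrac12\pi({\rm d}x)\mathbb{I}\{v\in\{-1,1\}\}$. Let \[P(x,{\rm d}y)=\tfrac12T_{1}(x,{\rm d}y)+\tfrac12T_{-1}(x,{\rm d}y)+\delta_{x}({\rm d}y)\big(1-\tfrac12T_{1}(x,\mathsf{X})-\tfrac12T_{-1}(x,\mathsf{X})\big).\] Let $\rho_{1,-1},\rho_{-1,1}:\mathsf{X}\to\mathbb{R}$ satisfy $\rho_{v,-v}(x)-\rho_{-v,v}(x)=T_{-v}(x,\mathsf{X})-T_{v}(x,\mathsf{X})$ and $\tilde\rho_{v,-v}(x)\leq\rho_{v,-v}(x)\leq1-T_{v}(x,\mathsf{X})$ for all $(x,v)\in E$, where $\tilde\rho_{v,-v}(x)=\max\{0,T_{-v}(x,\mathsf{X})-T_{v}(x,\mathsf{X})\}$, and define \[P^{{\rm lifted},\rho}\big((x,v);{\rm d}(y,w)\big)=\mathbb{I}\{w=v\}\big[T_{v}(x,{\rm d}y)+\delta_{x}({\rm d}y)\big(1-T_{v}(x,\mathsf{X})-\rho_{v,-v}(x)\big)\big]+\mathbb{I}\{w=-v\}\delta_{x}({\rm d}y)\rho_{v,-v}(x).\] Then for any $\lambda\in[0,1)$ and $f\in L^{2}(\pi)$,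 ${\rm var}_{\lambda}(f,P^{{\rm lifted},\rho})\leq{\rm var}_{\lambda}(f,P)$.
   Context: For a Markov kernel $K$ leaving a probability $\nu$ invariant, $\lambda\in[0,1)$, $g\in L^{2}(\nu)$, $\bar g=g-\nu(g)$: ${\rm var}_{\lambda}(g,K)=\|\bar g\|_{\nu}^{2}+2\sum_{k\geq1}\lambda^{k}\langle\bar g,K^{k}\bar g\rangle_{\nu}$. For $f\in L^{2}(\pi)$, ${\rm var}_{\lambda}(f,P^{{\rm lifted},\rho})$ means ${\rm var}_{\lambda}(\breve f,P^{{\rm lifted},\rho})$ computed under $\mu$ with $\breve f(x,v)=f(x)$, while ${\rm var}_{\lambda}(f,P)$ is computed under $\pi$. *)

(* Defs.v *)
From HB Require Import structures.
From mathcomp Require Import all_boot all_order all_algebra.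
From mathcomp Require Import all_classical all_reals all_analysis.
Set Implicit Arguments. Unset Strict Implicit. Unset Printing Implicit Defensive.
Import Order.TTheory GRing.Theory Num.Theory.
Local Open Scope classical_set_scope.
Local Open Scope ring_scope.

Section Defs.
Context {d : measure_display} {X : measurableType d} {R : realType}.

Definition Tsel (T1 Tm1 : R.-spker X ~> X) (v : bool) : R.-spker X ~> X :=
  if v then T1 else Tm1.

Definition kint (K : R.-spker X ~> X) (g : X -> R) (x : X) : R :=
  \int[K x]_(y in setT) g y.

Definition kmass (K : R.-spker X ~> X) (x : X) : R := fine (K x setT).

Definition P_op (T1 Tm1 : R.-spker X ~> X) (g : X -> R) (x : X) : R :=
  2^-1 * kint T1 g x + 2^-1 * kint Tm1 g x
  + g x * (1 - 2^-1 * kmass T1 x - 2^-1 * kmass Tm1 x).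

(* The lifted kernel P^{lifted,rho} on E = X * {-1,1} acting on functions;
   rho v x stands for rho_{v,-v}(x). *)
Definition Plift_op (T1 Tm1 : R.-spker X ~> X) (rho : bool -> X -> R)
    (h : X * bool -> R) (xv : X * bool) : R :=
  let x := xv.1 in let v := xv.2 in
  kint (Tsel T1 Tm1 v) (fun y => h (y, v)) x
  + h (x, v) * (1 - kmass (Tsel T1 Tm1 v) x - rho v x)
  + h (x, ~~ v) * rho v x.

Definition pi_int (pi : probability X R) (g : X -> R) : R :=
  \int[pi]_(x in setT) g x.

Definition mu_int (pi : probability X R) (h : X * bool -> R) : R :=
  2^-1 * (\int[pi]_(x in setT) h (x, true) + \int[pi]_(x in setT) h (x, false)).

End Defs.

(* The series is taken as the limit of partial sums (it converges absolutely).
   var_lambda(g, K) = ||gbar||^2_nu + 2 sum_{k>=1} lambda^k <gbar, K^k gbar>_nu,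
   where nu_int is integration against the invariant probability nu. *)
Definition var_lambda {T : Type} {R : realType} (nu_int : (T -> R) -> R)
    (K : (T -> R) -> (T -> R)) (lam : R) (g : T -> R) : R :=
  let gb := fun x => g x - nu_int g in
  nu_int (fun x => gb x ^+ 2)
  + 2 * limn (fun n => \sum_(1 <= k < n) (lam ^+ k * nu_int (fun x => gb x * iter k K gb x))).

(* Main.v *)
(* For u = (1 - lam P)^-1 f on X, g = (1 - lam L)^-1 f on E, with L the lifted
   operator, and D = g - u, one has <(1 - lam L) D, D> = <f, u> - <f, g>: L is
   adjoint to its conjugate by the flip v |-> -v, and the average of the two
   agrees with P on functions of x alone. This is nonnegative because L is a
   contraction. Truncated Neumann series replace the resolvents, so that no
   completeness of L^2 is needed, at the cost of an error O(lam^n). Operators are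
   only handled through the form <., .>, since kernels act linearly on
   square-integrable functions only almost everywhere. *)
Require Import Defs.
From HB Require Import structures.
From mathcomp Require Import all_boot all_order all_algebra.
From mathcomp Require Import all_classical all_reals all_analysis.
From mathcomp Require Import finmap measurable_realfun.
From mathcomp Require Import ring lra.
Import Order.TTheory GRing.Theory Num.Theory.
Import numFieldNormedType.Exports.
Local Open Scope classical_set_scope.
Local Open Scope ring_scope.

(** * Truncated resolvents *)

(** Up to the term [<f, f>], common to both operators, the series in [var_lambda] is
    [<f, (1 - lam K)^-1 f>], so the claim amounts to [<f, g> <= <f, u>]. The identity of the
    overview comes from [L + L' = 2 P] on functions of [x] alone, where [L'] is the adjoint of [L].
    This gives [<L u, u> = <P u, u>], hence [<(1 - lam L) u, u> = <f, u>], and it turns the sum of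
    the mixed terms [<(1 - lam L) g, u>] and [<(1 - lam L) u, g>] into
    [2 <(1 - lam P) u, g> = 2 <f, g>]. Both facts about [L] rest on the balance [kmass (T (~~ v)) +
    hold v + rho (~~ v) = 1], with [hold v] the probability of staying put, that is, on the
    invariance of [mu]: it makes Jensen's inequality integrate to a contraction, and it removes
    [rho] from [L + L']. *)

Definition neumann_sum {R : nzRingType} {V : lmodType R} (K : V -> V) (lam : R)
  (f : V) (n : nat) : V := \sum_(k < n) lam ^+ k *: iter k K f.

Section weak_resolvent.
Context {R : realType} {V : lmodType R} (S : V -> Prop) (ip : V -> V -> R).
Context (S0 : S 0) (Slin : forall a x y, S x -> S y -> S (a *: x + y)).
Context (ip_linear : forall a x y z, S x -> S y -> S z ->
  ip (a *: x + y) z = a * ip x z + ip y z).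
Context (ipC : forall x y, ip x y = ip y x).
Context (ip_ge0 : forall x, S x -> 0 <= ip x x).

Lemma form0 z : S z -> ip 0 z = 0.
Proof. by move=> Sz; have := ip_linear 1 0 0 z S0 S0 Sz; rewrite scaler0 addr0; lra. Qed.

Lemma formB x y z : S x -> S y -> S z -> ip (x - y) z = ip x z - ip y z.
Proof.
by move=> Sx Sy Sz; rewrite addrC -scaleN1r ip_linear// mulN1r addrC.
Qed.

(** Positivity at [x + y] and at [y - x] gives [2 * |ip x y| <= ip x x + ip y y]. This stands in for
    Cauchy-Schwarz, since the vectors compared share a bound [c]. *)
Lemma form_norm_le c x y : S x -> S y -> ip x x <= c -> ip y y <= c ->
  `|ip x y| <= c.
Proof.
move=> Sx Sy xc yc.
have SD a : S (a *: x + y) by exact: Slin.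
have ipD a : ip (a *: x + y) (a *: x + y) = a ^+ 2 * ip x x + 2 * a * ip x y + ip y y.
  rewrite ip_linear// (ipC x) (ipC y (a *: x + y)) !ip_linear// (ipC y x); ring.
have := ip_ge0 _ (SD 1); have := ip_ge0 _ (SD (-1)); rewrite !ipD.
by rewrite ler_norml => ? ?; apply/andP; split; lra.
Qed.

Section neumann.
Context (lam : R) (lam0 : 0 <= lam) (lam1 : lam < 1).
Context (S' : V -> Prop) (S'S : forall x, S' x -> S x).
Context (S'0 : S' 0) (S'lin : forall a x y, S' x -> S' y -> S' (a *: x + y)).
Context (K : V -> V) (S'K : forall x, S' x -> S' (K x)).
Context (K_linear : forall a x y z, S' x -> S' y -> S z ->
  ip (K (a *: x + y)) z = a * ip (K x) z + ip (K y) z).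
Context (f : V) (S'f : S' f).

Lemma iter_closed n : S' (iter n K f).
Proof. by elim: n => //= n; exact: S'K. Qed.

Lemma neumann_sumS n : neumann_sum K lam f n.+1 =
  lam ^+ n *: iter n K f + neumann_sum K lam f n.
Proof. by rewrite /neumann_sum big_ord_recr/= addrC. Qed.

Lemma neumann_closed n : S' (neumann_sum K lam f n).
Proof.
elim: n => [|n IH]; first by rewrite /neumann_sum big_ord0.
by rewrite neumann_sumS; apply: S'lin => //; exact: iter_closed.
Qed.

Lemma neumann_formE n z : S z ->
  ip (neumann_sum K lam f n) z = \sum_(k < n) lam ^+ k * ip (iter k K f) z.
Proof.
move=> Sz; elim: n => [|n IH]; first by rewrite /neumann_sum !big_ord0 form0.
rewrite neumann_sumS ip_linear//; last 2 first.
- exact/S'S/iter_closed.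
- exact/S'S/neumann_closed.
by rewrite IH big_ord_recr/= addrC.
Qed.

(** Telescoping of [(1 - lam K)] against the truncated series, carried out after pairing with [z]
    because [K] is linear only there. *)
Lemma neumann_resolvent n z : S z ->
  ip (neumann_sum K lam f n) z - lam * ip (K (neumann_sum K lam f n)) z =
  ip f z - lam ^+ n * ip (iter n K f) z.
Proof.
move=> Sz; elim: n => [|n IH].
  (* [K 0] need not be [0]; additivity at [0] only shows that it pairs to zero with [z]. *)
  have := K_linear 1 _ _ _ S'0 S'0 Sz; rewrite scaler0 addr0.
  rewrite /neumann_sum big_ord0 form0//= expr0 => h.
  suff -> : ip (K 0) z = 0 by ring.
  by lra.
have Sn := iter_closed n; have Sr := neumann_closed n.
rewrite neumann_sumS ip_linear//; [|exact: S'S|exact: S'S].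
rewrite K_linear// iterS exprS mulrDr opprD addrACA IH; ring.
Qed.

Context (c : R) (iter_le : forall n, ip (iter n K f) (iter n K f) <= c).

Lemma neumann_form_le n z : S z -> ip z z <= c ->
  `|ip (neumann_sum K lam f n) z| <= c / (1 - lam).
Proof.
move=> Sz zc.
have c0 : 0 <= c by apply: le_trans zc; exact: ip_ge0.
rewrite neumann_formE// (le_trans (ler_norm_sum _ _ _))//.
have h m : \sum_(k < m) lam ^+ k * c <= (1 - lam ^+ m) * (c / (1 - lam)).
  elim: m => [|m IH]; first by rewrite big_ord0 expr0 subrr mul0r.
  rewrite big_ord_recr/= exprS.
  have -> : (1 - lam * lam ^+ m) * (c / (1 - lam)) =
      (1 - lam ^+ m) * (c / (1 - lam)) + lam ^+ m * c.
    by field; rewrite subr_eq0 gt_eqF.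
  by rewrite lerD2r.
apply: (@le_trans _ _ (\sum_(k < n) lam ^+ k * c)).
  apply: ler_sum => k _; rewrite normrM normrX (ger0_norm lam0).
  rewrite ler_wpM2l ?exprn_ge0//; apply: form_norm_le => //.
  exact/S'S/iter_closed.
apply: (le_trans (h n)); rewrite ler_piMl//.
  by rewrite divr_ge0// subr_ge0 ltW.
by rewrite gerBl exprn_ge0.
Qed.

(** Only real numbers have to converge: after pairing with a fixed vector, the series is dominated
    termwise by a geometric one. *)
Lemma neumann_form_cvg z : S z -> ip z z <= c ->
  cvgn (fun n => ip (neumann_sum K lam f n) z).
Proof.
move=> Sz zc.
have c0 : 0 <= c by apply: le_trans zc; exact: ip_ge0.
have -> : (fun n => ip (neumann_sum K lam f n) z) =
    series (fun k => lam ^+ k * ip (iter k K f) z).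
  by apply/funext => n; rewrite neumann_formE// /series/= big_mkord.
apply: normed_cvg; apply: (series_le_cvg (v_ := geometric c lam)).
- by move=> n /=; exact: normr_ge0.
- by move=> n /=; rewrite mulr_ge0// exprn_ge0.
- move=> n /=; rewrite normrM normrX (ger0_norm lam0) mulrC.
  rewrite ler_wpM2r ?exprn_ge0//; apply: form_norm_le => //.
  exact/S'S/iter_closed.
- by apply: is_cvg_geometric_series; rewrite ger0_norm.
Qed.

Lemma sum_autocovariance_cvg : ip f f <= c ->
  \sum_(1 <= k < n) lam ^+ k * ip f (iter k K f) @[n --> \oo] -->
  limn (fun n => ip (neumann_sum K lam f n) f) - ip f f.
Proof.
(* At [n = 0] both sums are empty and the term [k = 0] cannot be split off; the shift skips this
   index. *)
move=> fc; rewrite -cvg_shiftS /=.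
have -> : (fun n => \sum_(1 <= k < n.+1) lam ^+ k * ip f (iter k K f)) =
    (fun n => ip (neumann_sum K lam f n.+1) f - ip f f).
  apply/funext => n; rewrite neumann_formE//; last exact: S'S.
  rewrite -(big_mkord xpredT (fun k => lam ^+ k * ip (iter k K f) f)).
  rewrite big_nat_recl//= expr0 mul1r addrAC subrr add0r big_add1/=.
  by apply: eq_bigr => k _; rewrite ipC.
apply: cvgB; last exact: cvg_cst.
rewrite (cvg_shiftS (fun n => ip (neumann_sum K lam f n) f)).
by apply: neumann_form_cvg => //; exact: S'S.
Qed.

End neumann.

(* Positivity of [I - lam L] is applied to the difference of the two truncated
   resolvents; all the terms which are quadratic in the resolvents cancel, up to
   the truncation error. *)
Lemma neumann_comparison (lam : R) (L P : V -> V) (Sx : V -> Prop) (f : V) :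
  0 <= lam -> lam < 1 ->
  (forall x, S x -> S (L x)) ->
  (forall a x y z, S x -> S y -> S z ->
    ip (L (a *: x + y)) z = a * ip (L x) z + ip (L y) z) ->
  (forall x, S x -> ip (L x) (L x) <= ip x x) ->
  (forall x, Sx x -> S x) -> Sx 0 ->
  (forall a x y, Sx x -> Sx y -> Sx (a *: x + y)) ->
  (forall x, Sx x -> Sx (P x)) ->
  (forall a x y z, Sx x -> Sx y -> S z ->
    ip (P (a *: x + y)) z = a * ip (P x) z + ip (P y) z) ->
  (forall x, Sx x -> ip (P x) (P x) <= ip x x) ->
  (forall u g, Sx u -> S g -> ip u (L g) = 2 * ip (P u) g - ip (L u) g) ->
  Sx f ->
  limn (fun n => \sum_(1 <= k < n) lam ^+ k * ip f (iter k L f)) <=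
  limn (fun n => \sum_(1 <= k < n) lam ^+ k * ip f (iter k P f)).
Proof.
move=> lam0 lam1 SL L_linear L_le SxS Sx0 Sxlin SxP P_linear P_le adj Sxf.
have Sf := SxS _ Sxf.
have itL n : S (iter n L f) by elim: n => //= n; exact: SL.
have itP n : Sx (iter n P f) by elim: n => //= n; exact: SxP.
have itL_le n : ip (iter n L f) (iter n L f) <= ip f f.
  by elim: n => //= n; apply: le_trans; exact: L_le.
have itP_le n : ip (iter n P f) (iter n P f) <= ip f f.
  by elim: n => //= n; apply: le_trans; exact/P_le.
have Sid x : S x -> S x by [].
have cvgL := sum_autocovariance_cvg _ lam0 lam1 _ Sid S0 Slin _ SL _ Sf _ itL_le (lexx _).
have cvgP := sum_autocovariance_cvg _ lam0 lam1 _ SxS Sx0 Sxlin _ SxP _ Sxf _ itP_le (lexx _).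
rewrite (cvg_lim _ cvgL)// (cvg_lim _ cvgP)// lerD2r.
pose g n := neumann_sum L lam f n; pose u n := neumann_sum P lam f n.
pose C := ip f f / (1 - lam).
have Sg n : S (g n) by exact: neumann_closed.
have Sxu n : Sx (u n) by exact: neumann_closed.
have Su n := SxS _ (Sxu n).
(* The truncation remainders are [lam ^+ n] times forms bounded by [C]: [<L^n f, g>] and
   [<P^n f, u>] occur once, [<P^n f, g>] twice, hence [4 * C]. *)
have key n : ip (g n) f <= ip (u n) f + 4 * C * lam ^+ n.
  have gE z (Sz : S z) :=
    neumann_resolvent lam _ Sid S0 Slin _ SL L_linear _ Sf n _ Sz.
  have uE z (Sz : S z) :=
    neumann_resolvent lam _ SxS Sx0 Sxlin _ SxP P_linear _ Sxf n _ Sz.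
  have bL z (Sz : S z) (zf : ip z z <= ip f f) :=
    neumann_form_le lam lam0 lam1 _ Sid S0 Slin _ SL _ Sf _ itL_le n _ Sz zf.
  have bP z (Sz : S z) (zf : ip z z <= ip f f) :=
    neumann_form_le lam lam0 lam1 _ SxS Sx0 Sxlin _ SxP _ Sxf _ itP_le n _ Sz zf.
  have SD : S (g n - u n) by rewrite addrC -scaleN1r; exact: Slin.
  have SLD := SL _ SD.
  have pos : lam * ip (L (g n - u n)) (g n - u n) <= ip (g n - u n) (g n - u n).
    have LD := form_norm_le _ _ _ SLD SD (L_le _ SD) (lexx _).
    apply: le_trans (ler_norm _) _; rewrite normrM (ger0_norm lam0).
    apply: le_trans (ler_wpM2l lam0 LD) _.
    by rewrite ler_piMl ?ip_ge0// ltW.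
  have LB z (Sz : S z) : ip (L (g n - u n)) z = ip (L (g n)) z - ip (L (u n)) z.
    by rewrite addrC -scaleN1r L_linear// mulN1r addrC.
  have e1 := gE _ (Sg n); have e2 := uE _ (Su n); have e3 := uE _ (Sg n).
  have a1 := adj _ _ (Sxu n) (Sg n); have a2 := adj _ _ (Sxu n) (Su n).
  have b1 := bL _ (itL n) (itL_le n).
  have b2 := bL _ (SxS _ (itP n)) (itP_le n).
  have b3 := bP _ (SxS _ (itP n)) (itP_le n).
  move: pos; rewrite LB// formB// ![ip _ (g n - u n)]ipC.
  rewrite !formB//; try exact: SL.
  move: e1 e2 e3 a1 a2 b1 b2 b3; rewrite -/(g n) -/(u n) -/C.
  rewrite (ipC (g n) (u n)) (ipC (g n) (L (u n))) (ipC (u n) (L (u n))).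
  rewrite (ipC (g n) (L (g n))) (ipC f (u n)) (ipC f (g n)).
  rewrite (ipC (g n) (iter n L f)) (ipC (g n) (iter n P f)) (ipC (u n) (iter n P f)).
  have := exprn_ge0 n lam0; rewrite !ler_norml.
  set l := lam ^+ n => l0 e1 e2 e3 a1 a2 /andP[b11 b12] /andP[b21 b22] /andP[b31 b32].
  have c1 := ler_wpM2l l0 b11; have c2 := ler_wpM2l l0 b22; have c3 := ler_wpM2l l0 b31.
  rewrite a1 (_ : ip (L (u n)) (u n) = ip (P (u n)) (u n)); last first.
    by move: a2; rewrite ipC; lra.
  move: c1 c2 c3 e1 e2 e3; rewrite !mulrN => c1 c2 c3 e1 e2 e3 pos.
  nra.
have cvgG : cvgn (fun n => ip (g n) f).
  exact: (neumann_form_cvg lam lam0 lam1 _ Sid S0 Slin _ SL _ Sf _ itL_le _ Sf (lexx _)).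
have cvgU : cvgn (fun n => ip (u n) f).
  exact: (neumann_form_cvg lam lam0 lam1 _ SxS Sx0 Sxlin _ SxP _ Sxf _ itP_le _ Sf (lexx _)).
have geo : 4 * C * lam ^+ n @[n --> \oo] --> (0 : R).
  by apply: cvg_geometric; rewrite ger0_norm.
have cvgUe : ip (u n) f + 4 * C * lam ^+ n @[n --> \oo] -->
    limn (fun n => ip (u n) f).
  by rewrite -[X in _ --> X]addr0; exact: cvgD.
by apply: (ler_cvg_to cvgG cvgUe); apply: nearW => n; exact: key.
Qed.

End weak_resolvent.

(** * Reversal of a kernel on nonnegative functions *)

Section positive_functional.
Local Open Scope ereal_scope.
Context {d} {X : measurableType d} {R : realType}.
Implicit Types (g h : X -> \bar R) (F : (X -> \bar R) -> \bar R).

Definition nonneg_measurable g := measurable_fun [set: X] g /\ forall x, 0 <= g x.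

(** What the extension from indicators to nonnegative measurable functions consumes. Both sides of
    the reversal identity have these properties in each argument, so no measure on the product space
    is built. *)
Definition positive_functional F := [/\
  forall g h, nonneg_measurable g -> nonneg_measurable h ->
    F (fun x => g x + h x) = F g + F h,
  forall (r : R) g, (0 <= r)%R -> nonneg_measurable g ->
    F (fun x => r%:E * g x) = r%:E * F g &
  forall g_ : (X -> \bar R)^nat, (forall n, nonneg_measurable (g_ n)) ->
    (forall x, nondecreasing_seq (g_ ^~ x)) ->
    F (fun x => limn (g_ ^~ x)) = limn (fun n => F (g_ n))].

Import HBNNSimple.

Lemma positive_functional_ext F G :
  positive_functional F -> positive_functional G ->
  (forall A, measurable A -> F (fun x => (\1_A x)%:E) = G (fun x => (\1_A x)%:E)) ->
  forall g, nonneg_measurable g -> F g = G g.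
Proof.
move=> [FD FZ Flim] [GD GZ Glim] FG1 g [mg g0].
pose g_ := nnsfun_approx measurableT mg.
have -> : g = fun x => limn (fun n => (g_ n x)%:E).
  by apply/funext => x; apply/esym/cvg_lim => //; exact: cvg_nnsfun_approx.
have nmg n : nonneg_measurable (fun x => (g_ n x)%:E).
  by split=> [|x]; [exact/measurable_EFinP|rewrite lee_fin].
have ndg x : nondecreasing_seq (fun n => (g_ n x)%:E).
  by move=> a b ab; rewrite lee_fin; exact/lefP/nd_nnsfun_approx.
rewrite (Flim (fun n x => (g_ n x)%:E))// (Glim (fun n x => (g_ n x)%:E))//.
congr (limn _); apply/funext => n.
(* A simple function is the finite sum of its values times the indicators of its level sets; the
   rest is an induction on the list of values. *)
pose s : seq R := fset_set (range (g_ n)).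
have -> : (fun x => (g_ n x)%:E) =
    fun x => \sum_(r <- s) (r%:E * (\1_(g_ n @^-1` [set r]) x)%:E).
  apply/funext => x; rewrite fimfunE fsbig_finite//= -sumEFin.
  by apply: eq_bigr => r _; rewrite EFinM.
have s0 r : r \in s -> (0 <= r)%R.
  move=> rs; have : r \in fset_set (range (g_ n)) by [].
  by rewrite in_fset_set// => /set_mem[x _ <-].
have m1 r : measurable (g_ n @^-1` [set r]) by [].
have nm1 r : nonneg_measurable (fun x => (\1_(g_ n @^-1` [set r]) x)%:E).
  by split=> [|x]; [exact/measurable_EFinP|rewrite lee_fin].
have nmZ r : (0 <= r)%R ->
    nonneg_measurable (fun x => r%:E * (\1_(g_ n @^-1` [set r]) x)%:E).
  move=> r0; case: (nm1 r) => m0 p0.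
  by split=> [|x]; [exact: measurable_funeM|rewrite mule_ge0].
have nm0 : nonneg_measurable (fun=> 0) by split.
have FG0 : F (fun=> 0) = G (fun=> 0).
  have h := FG1 _ measurable0.
  rewrite (_ : (fun=> 0) = fun x => (\1_(@set0 X) x)%:E)//.
  by apply/funext => x; rewrite indic0.
elim: s s0 => [|r t IH] s0; first by under eq_fun do rewrite big_nil.
have r0 : (0 <= r)%R by apply: s0; rewrite mem_head.
have t0 q : q \in t -> (0 <= q)%R by move=> qt; apply: s0; rewrite in_cons qt orbT.
have nmt : nonneg_measurable
    (fun x => \sum_(r <- t) (r%:E * (\1_(g_ n @^-1` [set r]) x)%:E)).
  elim: t t0 {IH s0} => [|q t IH] t0; first by under eq_fun do rewrite big_nil.
  under eq_fun do rewrite big_cons.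
  have [mq q0] : nonneg_measurable (fun x => q%:E * (\1_(g_ n @^-1` [set q]) x)%:E).
    by apply: nmZ; apply: t0; rewrite mem_head.
  have [mt pt] := IH (fun p pt => t0 p (mem_behead (s := q :: t) pt)).
  by split=> [|x]; [exact: emeasurable_funD|rewrite adde_ge0].
under eq_fun do rewrite big_cons.
rewrite (FD (fun x => r%:E * _))//; last exact: nmZ.
rewrite (GD (fun x => r%:E * _))//; last exact: nmZ.
by rewrite FZ// GZ// IH// FG1.
Qed.

(** The factor may be [+oo], where multiplication is not continuous: either every [u n] is [0], or
    some term is positive and all products are [+oo] from there on. *)
Lemma ge0_mule_limn (c : \bar R) (u : (\bar R)^nat) : 0 <= c ->
  (forall n, 0 <= u n) -> nondecreasing_seq u ->
  c * limn u = limn (fun n => c * u n).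
Proof.
move=> c0 u0 ndu; have cu := ereal_nondecreasing_is_cvgn ndu.
case: c c0 => [r _|_|//]; first by rewrite limeMl.
have [u_0|] := pselect (forall n, u n = 0).
  rewrite (_ : u = cst 0); last exact/funext.
  by under eq_fun do rewrite /cst mule0; rewrite !lim_cst// mule0.
move=> /existsNP[N /eqP uN]; have {uN} uN0 : 0 < u N by rewrite lt0e uN u0.
have lim0 : 0 < limn u.
  apply: lt_le_trans uN0 _; rewrite (cvg_lim _ (ereal_nondecreasing_cvgn ndu))//.
  by apply: ereal_sup_ubound; exists N.
rewrite gt0_mulye//; apply/esym/cvg_lim => //.
have : \forall n \near \oo, +oo * u n = +oo; last exact: cvg_near_cst.
exists N => // n /= Nn; apply: gt0_mulye; apply: lt_le_trans uN0 _; exact: ndu.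
Qed.

(** Covers both sides of the reversal identity: [K] is either a sub-stochastic kernel or the Dirac
    kernel, the latter turning an inner integral into an evaluation. *)
Lemma integral_kernel_functional {d'} {Y : measurableType d'}
  (m : {measure set Y -> \bar R}) (K : Y -> {measure set X -> \bar R})
  (mK : forall U, measurable U -> measurable_fun [set: Y] (K ^~ U))
  (h : Y -> \bar R) :
  measurable_fun [set: Y] h -> (forall y, 0 <= h y) ->
  positive_functional (fun g => \int[m]_y (h y * \int[K y]_x g x)).
Proof.
move=> mh h0.
have mKg g : nonneg_measurable g -> measurable_fun [set: Y] (fun y => \int[K y]_x g x).
  by move=> [mg g0]; exact: measurable_fun_integral_kernel.
have Kg0 g y : nonneg_measurable g -> 0 <= \int[K y]_x g x.
  by move=> [mg g0]; exact: integral_ge0.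
split=> [g k [mg g0] [mk k0]|r g r0 [mg g0]|g_ nmg ndg].
- rewrite -ge0_integralD//; last 4 first.
  + by move=> y _; rewrite mule_ge0// Kg0.
  + by apply: emeasurable_funM => //; exact: mKg.
  + by move=> y _; rewrite mule_ge0// Kg0.
  + by apply: emeasurable_funM => //; exact: mKg.
  apply: eq_integral => y _; rewrite ge0_integralD// ge0_muleDr//; exact: integral_ge0.
- rewrite -ge0_integralZl//; last 2 first.
  + by apply: emeasurable_funM => //; exact: mKg.
  + by move=> y _; rewrite mule_ge0// Kg0.
  by apply: eq_integral => y _; rewrite ge0_integralZl// muleCA.
- have Klim y : \int[K y]_x limn (g_ ^~ x) = limn (fun n => \int[K y]_x g_ n x).
    rewrite monotone_convergence//; last 2 first.
    + by move=> n; case: (nmg n).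
    + by move=> n x _; case: (nmg n).
  have ndK y : nondecreasing_seq (fun n => \int[K y]_x g_ n x).
    move=> a b ab; apply: ge0_le_integral => //.
    + by move=> x _; case: (nmg a).
    + by case: (nmg a).
    + by case: (nmg b).
    + by move=> x _; exact: ndg.
  rewrite -monotone_convergence//; last 3 first.
  + by move=> n; apply: emeasurable_funM => //; exact: mKg.
  + by move=> n y _; rewrite mule_ge0// Kg0.
  + by move=> y _ a b ab; rewrite lee_wpmul2l//; exact: ndK.
  by apply: eq_integral => y _; rewrite Klim ge0_mule_limn// => n; exact: Kg0.
Qed.

End positive_functional.

Section reversal.
Local Open Scope ereal_scope.
Context {d} {X : measurableType d} {R : realType}.
Implicit Types (pi : probability X R) (T : R.-spker X ~> X) (g h : X -> \bar R).

(** Equality of the measures [pi(dx) T(x, dy)] and [pi(dy) T'(y, dx)], tested on rectangles. *)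
Definition reversal pi T T' := forall A B : set X, measurable A -> measurable B ->
  \int[pi]_(x in A) T x B = \int[pi]_(y in B) T' y A.

Lemma reversal_sym pi T T' : reversal pi T T' -> reversal pi T' T.
Proof. by move=> TT' A B mA mB; rewrite TT'. Qed.

Lemma integral_indic_mul pi (k : X -> \bar R) A : measurable A ->
  \int[pi]_(x in A) k x = \int[pi]_x ((\1_A x)%:E * k x).
Proof.
move=> mA; rewrite integral_mkcond; apply: eq_integral => x _.
by rewrite /patch indicE; case: ifPn => xA; rewrite ?mul1e ?mul0e.
Qed.

(** One argument is extended at a time: [half] passes from indicators to arbitrary [g] with [h] an
    indicator, then [h] is extended with [g] fixed. *)
Lemma reversal_integral pi T T' g h : reversal pi T T' ->
  nonneg_measurable g -> nonneg_measurable h ->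
  \int[pi]_x (h x * \int[T x]_y g y) = \int[pi]_y (g y * \int[T' y]_x h x).
Proof.
move=> TT' nmg nmh; have [mg g0] := nmg; have [mh h0] := nmh.
have dE y (k : X -> \bar R) : measurable_fun [set: X] k -> \int[\d_y]_x k x = k y.
  by move=> mk; rewrite integral_dirac// diracT mul1e.
have m1 A : measurable A -> measurable_fun [set: X] (fun x => (\1_A x)%:E : \bar R).
  by move=> mA; apply/measurable_EFinP.
have half A k : measurable A -> nonneg_measurable k ->
    \int[pi]_x ((\1_A x)%:E * \int[T x]_y k y) = \int[pi]_y (k y * T' y A).
  move=> mA nmk.
  (* Writing [k y] as an integral against the Dirac mass at [y] brings the right-hand side under
     [integral_kernel_functional]. *)
  transitivity (\int[pi]_y (T' y A * \int[\d_y]_x k x)); last first.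
    by apply: eq_integral => y _; rewrite (dE _ _ nmk.1) muleC.
  move: k nmk; apply: positive_functional_ext.
  - apply: integral_kernel_functional => //; first exact: measurable_kernel.
    by apply: m1.
  - by apply: integral_kernel_functional => //; exact: measurable_kernel.
  move=> B mB; transitivity (\int[pi]_(x in A) T x B).
    rewrite [RHS]integral_indic_mul//; apply: eq_integral => x _.
    by rewrite integral_indic// setIT.
  rewrite TT'// [LHS]integral_indic_mul//; apply: eq_integral => y _.
  by rewrite (dE _ _ (m1 _ mB)) muleC.
transitivity (\int[pi]_x ((\int[T x]_y g y) * \int[\d_x]_y h y)).
  by apply: eq_integral => x _; rewrite (dE _ _ mh) muleC.
move: h nmh {mh h0}; apply: positive_functional_ext.
- apply: integral_kernel_functional => //.
    apply: measurable_fun_integral_kernel => //; exact: measurable_kernel.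
  by move=> x; exact: integral_ge0.
- by apply: integral_kernel_functional => //; exact: measurable_kernel.
move=> A mA; transitivity (\int[pi]_x ((\1_A x)%:E * \int[T x]_y g y)).
  by apply: eq_integral => x _; rewrite (dE _ _ (m1 _ mA)) muleC.
rewrite half//; apply: eq_integral => y _.
by rewrite integral_indic// setIT.
Qed.

(** Reversal against the constant [1] leaves the weight [T' y X <= 1]: [pi] is sub-invariant for
    [T]. This is the source of all square-integrability of [kint]. *)
Lemma reversal_integral_le pi T T' g : reversal pi T T' -> nonneg_measurable g ->
  \int[pi]_x \int[T x]_y g y <= \int[pi]_x g x.
Proof.
move=> TT' nmg; have [mg g0] := nmg.
have nm1 : nonneg_measurable (cst 1 : X -> \bar R) by split.
have -> : \int[pi]_x \int[T x]_y g y = \int[pi]_x (1 * \int[T x]_y g y).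
  by apply: eq_integral => x _; rewrite mul1e.
rewrite (reversal_integral _ _ _ _ _ TT' nmg nm1).
apply: ge0_le_integral => //.
- by move=> x _; rewrite mule_ge0// integral_ge0.
- apply: emeasurable_funM => //; apply: measurable_fun_integral_kernel => //.
  exact: measurable_kernel.
- move=> x _; rewrite integral_cst// mul1e -[leRHS]mule1 lee_wpmul2l//.
  exact: sprob_kernel_le1.
Qed.

End reversal.

(** * Kernels acting on square-integrable functions *)

Section square_integrable.
Context {d} {X : measurableType d} {R : realType} (pi : probability X R).
Implicit Types (u v w : X -> R) (T : R.-spker X ~> X).

Definition square_integrable u :=
  measurable_fun setT u /\ pi.-integrable setT (fun x => (u x ^+ 2)%:E).

(** The factor [2] accommodates [(v + w)^2 <= 2 (v^2 + w^2)]; with [v = w] it also serves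
    multipliers and positive parts. *)
Lemma square_integrable_le u v w : measurable_fun setT u ->
  square_integrable v -> square_integrable w ->
  (forall x, u x ^+ 2 <= 2 * (v x ^+ 2 + w x ^+ 2)) -> square_integrable u.
Proof.
move=> mu [mv iv] [mw iw] uvw; split => //.
have i2 : pi.-integrable setT (fun x => (2 * (v x ^+ 2 + w x ^+ 2))%:E).
  exact: (integrableZl measurableT 2 (integrableD measurableT iv iw)).
apply: (le_integrable measurableT _ _ i2).
  by apply/measurable_EFinP; exact: measurable_funX.
move=> x _ /=; rewrite lee_fin !ger0_norm ?sqr_ge0//.
by rewrite mulr_ge0// addr_ge0// sqr_ge0.
Qed.

Lemma square_integrable0 : square_integrable (fun=> 0).
Proof.
split; first exact: measurable_cst.
by under eq_fun do rewrite expr0n/=; exact: integrable0.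
Qed.

Lemma square_integrableZ (a : R) u : square_integrable u ->
  square_integrable (fun x => a * u x).
Proof.
move=> [mu iu]; split; first exact: measurable_funM.
have := integrableZl measurableT (a ^+ 2) iu.
by under [X in _ -> _.-integrable _ X]eq_fun do rewrite exprMn EFinM.
Qed.

Lemma square_integrableMD (a : R) u v : square_integrable u ->
  square_integrable v -> square_integrable (fun x => a * u x + v x).
Proof.
move=> iu iv; have iau := square_integrableZ a _ iu.
apply: (square_integrable_le _ _ _ _ iau iv) => [|x].
  by apply: measurable_funD; [case: iau|case: iv].
have := sqr_ge0 (a * u x - v x); nra.
Qed.

Lemma square_integrableMb (c : X -> R) u : measurable_fun setT c ->
  (forall x, `|c x| <= 1) -> square_integrable u ->
  square_integrable (fun x => u x * c x).
Proof.
move=> mc c1 iu; have [mu _] := iu.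
apply: (square_integrable_le _ _ _ _ iu iu) => [|x]; first exact: measurable_funM.
rewrite exprMn; have : c x ^+ 2 <= 1 by rewrite -real_normK ?num_real// expr_le1.
have := sqr_ge0 (u x); nra.
Qed.

Lemma square_integrable_mul u v : square_integrable u -> square_integrable v ->
  pi.-integrable setT (fun x => (u x * v x)%:E).
Proof.
move=> [mu iu] [mv iv].
have iuv : pi.-integrable setT (fun x => (u x ^+ 2 + v x ^+ 2)%:E).
  exact: (integrableD measurableT iu iv).
apply: (le_integrable measurableT _ _ iuv).
  by apply/measurable_EFinP; exact: measurable_funM.
move=> x _ /=; rewrite lee_fin.
rewrite (ger0_norm (addr_ge0 (sqr_ge0 _) (sqr_ge0 _))) ler_norml.
have := sqr_ge0 (u x - v x); have := sqr_ge0 (u x + v x).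
have := sqr_ge0 (u x); have := sqr_ge0 (v x).
by move=> *; apply/andP; split; nra.
Qed.

Lemma square_integrable_cst (a : R) : square_integrable (fun=> a).
Proof.
split; first exact: measurable_cst.
exact: (finite_measure_integrable_cst pi (a ^+ 2) measurableT).
Qed.

Definition inner u v := pi_int pi (fun x => u x * v x).

Lemma innerC u v : inner u v = inner v u.
Proof. by rewrite /inner /pi_int; apply: eq_Rintegral => x _; rewrite mulrC. Qed.

Lemma innerMD (a : R) u v w : square_integrable u -> square_integrable v ->
  square_integrable w -> inner (fun x => a * u x + v x) w = a * inner u w + inner v w.
Proof.
move=> iu iv iw; rewrite /inner /pi_int.
have iuw := square_integrable_mul _ _ iu iw.
have ivw := square_integrable_mul _ _ iv iw.
rewrite -RintegralZl// -RintegralD//; last exact: (integrableZl measurableT a iuw).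
by apply: eq_Rintegral => x _; rewrite mulrDl mulrA.
Qed.

Lemma square_integrableD u v : square_integrable u -> square_integrable v ->
  square_integrable (fun x => u x + v x).
Proof.
move=> iu iv; have := square_integrableMD 1 _ _ iu iv.
by under [X in square_integrable X -> _]eq_fun do rewrite mul1r.
Qed.

Lemma innerD u v w : square_integrable u -> square_integrable v ->
  square_integrable w -> inner (fun x => u x + v x) w = inner u w + inner v w.
Proof.
move=> iu iv iw; have := innerMD 1 _ _ _ iu iv iw; rewrite mul1r => <-.
by congr inner; apply/funext => x; rewrite mul1r.
Qed.

Lemma innerZ (a : R) u w : square_integrable u -> square_integrable w ->
  inner (fun x => a * u x) w = a * inner u w.
Proof.
move=> iu iw; rewrite /inner /pi_int -RintegralZl//; last first.
  exact: square_integrable_mul iu iw.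
by apply: eq_Rintegral => x _; rewrite mulrA.
Qed.

Lemma inner_ge0 u : 0 <= inner u u.
Proof. by apply: Rintegral_ge0 => x _; rewrite -expr2 sqr_ge0. Qed.

Lemma ae_eq_inner u v w : measurable_fun setT u -> measurable_fun setT v ->
  measurable_fun setT w -> {ae pi, forall x, u x = v x} -> inner u w = inner v w.
Proof.
move=> mu mv mw uv; congr fine; apply: ae_eq_integral => //.
- by apply/measurable_EFinP; exact: measurable_funM.
- by apply/measurable_EFinP; exact: measurable_funM.
- by apply: filterS uv => x -> _.
Qed.

End square_integrable.

(** * Sub-stochastic kernels as operators on L^2(pi) *)

Section kernel_square_integrable.
Context {d} {X : measurableType d} {R : realType} (pi : probability X R).
Implicit Types (u v w : X -> R) (T : R.-spker X ~> X).

Lemma kmassE T x : (kmass T x)%:E = T x setT.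
Proof.
rewrite fineK// ge0_fin_numE//.
by rewrite (le_lt_trans (sprob_kernel_le1 T x))// ltry.
Qed.

Lemma kmass_ge0 T x : 0 <= kmass T x.
Proof. by rewrite -lee_fin kmassE. Qed.

Lemma kmass_le1 T x : kmass T x <= 1.
Proof. by rewrite -lee_fin kmassE sprob_kernel_le1. Qed.

Lemma measurable_kmass T : measurable_fun setT (kmass T).
Proof. by apply: measurableT_comp => //; exact: measurable_kernel. Qed.

Lemma measurable_kint T u : measurable_fun setT u -> measurable_fun setT (kint T u).
Proof.
move=> mu; apply: measurableT_comp => //.
under eq_fun do rewrite integralE.
have mEu : measurable_fun setT (EFin \o u) by exact/measurable_EFinP.
by apply: emeasurable_funB; apply: measurable_fun_integral_kernel => //;
  [exact: measurable_kernel|exact: measurable_funepos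
  |exact: measurable_kernel|exact: measurable_funeneg].
Qed.

Lemma kernel_integrable_cst T x (a : R) : (T x).-integrable setT (fun=> a%:E).
Proof.
apply/integrableP; split; first exact: measurable_cst.
rewrite integral_cst//= -kmassE -EFinM; exact: ltry.
Qed.

Lemma kernel_integrable T u x : measurable_fun setT u ->
  (T x).-integrable setT (fun y => (u y ^+ 2)%:E) ->
  (T x).-integrable setT (EFin \o u).
Proof.
move=> mu iu.
have iu1 : (T x).-integrable setT (fun y => (1 + u y ^+ 2)%:E).
  exact: (integrableD measurableT (kernel_integrable_cst T x 1) iu).
apply: (le_integrable measurableT _ _ iu1); first exact/measurable_EFinP.
move=> y _ /=; rewrite lee_fin ler_norml.
have := sqr_ge0 (u y - 1); have := sqr_ge0 (u y + 1); have u2 := sqr_ge0 (u y).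
rewrite ger0_norm; last by rewrite addr_ge0.
by move=> *; apply/andP; split; nra.
Qed.

Lemma kint_lin T (a : R) u v x : (T x).-integrable setT (EFin \o u) ->
  (T x).-integrable setT (EFin \o v) ->
  kint T (fun y => a * u y + v y) x = a * kint T u x + kint T v x.
Proof.
move=> iu iv; rewrite /kint RintegralD//; last exact: (integrableZl measurableT a iu).
by rewrite RintegralZl.
Qed.

(* Expands [T (u - c)^2 (x) >= 0]; minimising over [c] gives Jensen's inequality. *)
Lemma kint_variance T u x (c : R) : measurable_fun setT u ->
  (T x).-integrable setT (fun y => (u y ^+ 2)%:E) ->
  0 <= c ^+ 2 * kmass T x - 2 * c * kint T u x + kint T (fun y => u y ^+ 2) x.
Proof.
move=> mu iu2; have iu := kernel_integrable _ _ _ mu iu2.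
have icst := kernel_integrable_cst T x (c ^+ 2).
have : 0 <= kint T (fun y => (- (2 * c)) * u y + (c ^+ 2 + u y ^+ 2)) x.
  apply: Rintegral_ge0 => y _; have := sqr_ge0 (u y - c); nra.
rewrite kint_lin//; last exact: (integrableD measurableT icst iu2).
rewrite {2}/kint RintegralD// (Rintegral_cst _ measurableT) -/(kmass T x).
rewrite -/(kint T (fun y => u y ^+ 2) x); lra.
Qed.

Context (T T' : R.-spker X ~> X) (TT' : reversal pi T T').

Lemma nonneg_measurable_sqr u : measurable_fun setT u ->
  nonneg_measurable (fun x => (u x ^+ 2)%:E).
Proof.
move=> mu; split; first by apply/measurable_EFinP; exact: measurable_funX.
by move=> x; rewrite lee_fin sqr_ge0.
Qed.

Lemma kernel_sqr_finite u : square_integrable pi u ->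
  pi.-integrable setT (fun x => \int[T x]_y (u y ^+ 2)%:E)%E.
Proof.
move=> [mu iu]; have nmu := nonneg_measurable_sqr _ mu; have [mu2 u20] := nmu.
apply/integrableP; split.
  by apply: measurable_fun_integral_kernel => //; exact: measurable_kernel.
under eq_integral do rewrite gee0_abs ?integral_ge0//.
apply: le_lt_trans (reversal_integral_le _ _ _ _ TT' nmu) _.
case/integrableP : iu => _; by under eq_integral do rewrite gee0_abs ?u20//.
Qed.

(** [T u^2] has a finite [pi]-integral by sub-invariance, hence is finite almost everywhere. On the
    exceptional null set [kint] may take a default value, which is why linearity and Jensen hold
    only almost everywhere. *)
Lemma ae_kernel_sqr_integrable u : square_integrable pi u ->
  {ae pi, forall x, (T x).-integrable setT (fun y => (u y ^+ 2)%:E)}.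
Proof.
move=> iu; have [mu _] := iu; have [mu2 u20] := nonneg_measurable_sqr _ mu.
have := integrable_ae measurableT (kernel_sqr_finite _ iu).
apply: filterS => x /(_ Logic.I) fin.
apply/integrableP; split => //.
under eq_integral do rewrite gee0_abs ?u20//.
by rewrite -ge0_fin_numE// integral_ge0.
Qed.

Lemma ae_kint_lin (a : R) u v : square_integrable pi u -> square_integrable pi v ->
  {ae pi, forall x, kint T (fun y => a * u y + v y) x = a * kint T u x + kint T v x}.
Proof.
move=> iu iv.
apply: filterS2 (ae_kernel_sqr_integrable _ iu) (ae_kernel_sqr_integrable _ iv).
by move=> x iux ivx; apply: kint_lin; apply: kernel_integrable => //; [case: iu|case: iv].
Qed.

Lemma ae_kint_variance u (c : X -> R) : square_integrable pi u ->
  {ae pi, forall x, 0 <= c x ^+ 2 * kmass T x - 2 * c x * kint T u x +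
                         kint T (fun y => u y ^+ 2) x}.
Proof.
move=> iu; apply: filterS (ae_kernel_sqr_integrable _ iu) => x ix.
by apply: kint_variance => //; case: iu.
Qed.

Lemma integrable_kint_sqr u : square_integrable pi u ->
  pi.-integrable setT (fun x => (kint T (fun y => u y ^+ 2) x)%:E).
Proof.
move=> iu; have [mu _] := iu.
apply: (le_integrable measurableT _ _ (kernel_sqr_finite _ iu)).
  by apply/measurable_EFinP/measurable_kint/measurable_funX.
(* [fine] sends [+oo] to [0], so the real-valued integral stays below the extended one at every
   point. *)
move=> x _; rewrite /kint /Rintegral.
have : (0 <= \int[T x]_y (u y ^+ 2)%:E)%E.
  by apply: integral_ge0 => y _; rewrite lee_fin sqr_ge0.
by case: integral => [r| |]//= _; rewrite normr0 leey.
Qed.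

Lemma square_integrable_kint u : square_integrable pi u ->
  square_integrable pi (kint T u).
Proof.
move=> iu; have [mu _] := iu.
have mk := measurable_kint T _ mu; split => //.
apply/integrableP; split; first by apply/measurable_EFinP; exact: measurable_funX.
have /integrableP[mk2 fin] := integrable_kint_sqr _ iu.
apply: le_lt_trans fin; apply: ae_ge0_le_integral => //.
- by apply: measurableT_comp => //; apply/measurable_EFinP; exact: measurable_funX.
- exact: measurableT_comp.
(* With [c] equal to [kint T u x] and mass at most one, nonnegativity of the variance yields
   [(kint T u x)^2 <= kint T u^2 x]. *)
apply: filterS (ae_kint_variance _ (kint T u) iu) => x h _ /=.
rewrite lee_fin ger0_norm ?sqr_ge0// (le_trans _ (ler_norm _))//.
have := sqr_ge0 (kint T u x); have := kmass_le1 T x; have := kmass_ge0 T x; nra.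
Qed.

End kernel_square_integrable.

(** * Adjointness of a kernel and its reversal in L^2(pi) *)

Section kint_adjoint.
Context {d} {X : measurableType d} {R : realType} (pi : probability X R).
Implicit Types (u v w : X -> R).
Context (T T' : R.-spker X ~> X) (TT' : reversal pi T T').

Lemma inner_kintMD (a : R) u v w : square_integrable pi u -> square_integrable pi v ->
  square_integrable pi w ->
  inner pi (kint T (fun x => a * u x + v x)) w =
  a * inner pi (kint T u) w + inner pi (kint T v) w.
Proof.
move=> iu iv iw; have iuv := square_integrableMD _ a _ _ iu iv.
have ku := square_integrable_kint _ _ _ TT' _ iu.
have kv := square_integrable_kint _ _ _ TT' _ iv.
have kuv := square_integrable_kint _ _ _ TT' _ iuv.
rewrite -innerMD//; apply: ae_eq_inner.
- by case: kuv.
- by case: (square_integrableMD _ a _ _ ku kv).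
- by case: iw.
- exact: ae_kint_lin TT' _ _ _ iu iv.
Qed.

(** For nonnegative functions the identity holds between extended integrals; integrability almost
    everywhere ensures that passing to real values loses nothing. *)
Lemma pi_int_kint_ge0 u v : measurable_fun setT u -> measurable_fun setT v ->
  (forall x, 0 <= u x) -> (forall x, 0 <= v x) ->
  {ae pi, forall x, (T x).-integrable setT (EFin \o u)} ->
  {ae pi, forall x, (T' x).-integrable setT (EFin \o v)} ->
  pi_int pi (fun x => v x * kint T u x) = pi_int pi (fun x => u x * kint T' v x).
Proof.
move=> mu mv u0 v0 iu iv.
have mEu : measurable_fun setT (EFin \o u) by exact/measurable_EFinP.
have mEv : measurable_fun setT (EFin \o v) by exact/measurable_EFinP.
congr fine.
transitivity (\int[pi]_x ((v x)%:E * \int[T x]_y (u y)%:E))%E.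
  apply: ae_eq_integral => //.
  - by apply/measurable_EFinP; apply: measurable_funM => //; exact: measurable_kint.
  - apply: emeasurable_funM => //; apply: measurable_fun_integral_kernel => //.
    exact: measurable_kernel.
  - apply: filterS iu => x iux _.
    by rewrite EFinM fineK//; exact: integrable_fin_num.
rewrite (reversal_integral _ _ _ (EFin \o u) (EFin \o v) TT'); last 2 first.
- by split=> // x; rewrite lee_fin.
- by split=> // x; rewrite lee_fin.
apply: ae_eq_integral => //.
- apply: emeasurable_funM => //; apply: measurable_fun_integral_kernel => //.
  exact: measurable_kernel.
- by apply/measurable_EFinP; apply: measurable_funM => //; exact: measurable_kint.
- apply: filterS iv => x ivx _.
  by rewrite EFinM fineK//; exact: integrable_fin_num.
Qed.

(** Reversal against the constant [1]. The nonnegative form is needed because [u ^+ 2] is integrable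
    but may fail to be square integrable. *)
Lemma pi_int_kint_sqr u : square_integrable pi u ->
  pi_int pi (kint T (fun x => u x ^+ 2)) = inner pi (fun x => u x * kmass T' x) u.
Proof.
move=> iu; have [mu _] := iu.
transitivity (pi_int pi (fun x => 1 * kint T (fun x => u x ^+ 2) x)).
  by apply: eq_Rintegral => x _; rewrite mul1r.
rewrite (pi_int_kint_ge0 _ (fun=> 1)).
- apply: eq_Rintegral => x _.
  by rewrite /kint Rintegral_cst// mul1r -/(kmass T' x); ring.
- exact: measurable_funX.
- exact: measurable_cst.
- by move=> x; exact: sqr_ge0.
- by move=> x; exact: ler01.
- exact: ae_kernel_sqr_integrable TT' _ iu.
- by apply: aeW => x; exact: kernel_integrable_cst.
Qed.

End kint_adjoint.

Section kint_adjoint_signed.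
Context {d} {X : measurableType d} {R : realType} (pi : probability X R).
Implicit Types (u v w : X -> R).

(** Positive and negative parts, written with the coefficient [-1] to fit the shape [a * u + v] of
    the linearity lemmas. *)
Lemma square_integrable_split u : square_integrable pi u ->
  exists p n, [/\ square_integrable pi p, square_integrable pi n,
    (forall x, 0 <= p x), (forall x, 0 <= n x) & u = fun x => -1 * n x + p x].
Proof.
move=> iu; have [mu _] := iu.
exists (fun x => Num.max (u x) 0), (fun x => Num.max (- u x) 0); split.
- apply: (square_integrable_le _ _ _ _ _ iu iu) => [|x].
    by apply: measurable_maxr => //; exact: measurable_cst.
  by have := sqr_ge0 (u x); case: (leP (u x) 0) => ? ?; nra.
- apply: (square_integrable_le _ _ _ _ _ iu iu) => [|x].
    apply: measurable_maxr; last exact: measurable_cst.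
    exact: measurable_funN.
  by have := sqr_ge0 (u x); case: (leP (- u x) 0) => ? ?; nra.
- by move=> x; rewrite le_max lexx orbT.
- by move=> x; rewrite le_max lexx orbT.
- by apply/funext => x; case: (leP (u x) 0); case: (leP (- u x) 0); lra.
Qed.

Context (T T' : R.-spker X ~> X) (TT' : reversal pi T T').

(** From the nonnegative case by linearity: the left argument is split into its parts, then the
    right one. *)
Lemma inner_kint u v : square_integrable pi u -> square_integrable pi v ->
  inner pi (kint T u) v = inner pi u (kint T' v).
Proof.
have T'T := reversal_sym _ _ _ TT'.
have nn p q : square_integrable pi p -> square_integrable pi q ->
    (forall x, 0 <= p x) -> (forall x, 0 <= q x) ->
    inner pi (kint T p) q = inner pi p (kint T' q).
  move=> ip iq p0 q0; have [mp _] := ip; have [mq _] := iq.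
  rewrite innerC; apply: (pi_int_kint_ge0 _ _ _ TT') => //.
  - apply: filterS (ae_kernel_sqr_integrable _ _ _ TT' _ ip) => x.
    exact: kernel_integrable.
  - apply: filterS (ae_kernel_sqr_integrable _ _ _ T'T _ iq) => x.
    exact: kernel_integrable.
have half w q : square_integrable pi w -> square_integrable pi q ->
    (forall x, 0 <= q x) -> inner pi (kint T w) q = inner pi w (kint T' q).
  move=> iw iq q0; have [p [n [ip iN p0 n0 ->]]] := square_integrable_split _ iw.
  rewrite (inner_kintMD _ _ _ TT')// innerMD//; last first.
    exact: square_integrable_kint T'T _ iq.
  by rewrite !nn.
move=> iu iv; have [q [m [iq im q0 m0 ->]]] := square_integrable_split _ iv.
have ku := square_integrable_kint _ _ _ TT' _ iu.
rewrite innerC innerMD// ![inner _ _ (kint T u)]innerC !half//.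
by rewrite [RHS]innerC (inner_kintMD _ _ _ T'T)// ![inner _ u _]innerC.
Qed.

End kint_adjoint_signed.

(** * The lifted operator *)

Section lifted.
Context {d} {X : measurableType d} {R : realType} (pi : probability X R).
Context (T1 Tm1 : R.-spker X ~> X) (rho : bool -> X -> R).
Context (hrev : reversal pi T1 Tm1).
Context (hrho_meas : forall v, measurable_fun setT (rho v)).
Context (hrho_diff : forall x v, rho v x - rho (~~ v) x
  = kmass (Tsel T1 Tm1 (~~ v)) x - kmass (Tsel T1 Tm1 v) x).
Context (hrho_ge0 : forall x v, 0 <= rho v x).
Context (hrho_hi : forall x v, rho v x <= 1 - kmass (Tsel T1 Tm1 v) x).
Implicit Types (h k : X * bool -> R) (u w : X -> R).

Local Notation T := (Tsel T1 Tm1).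
Local Notation L := (Plift_op T1 Tm1 rho).
Local Notation L2 := (square_integrable pi).
Local Notation side h v := (fun x => h (x, v)).

Let Trev v : reversal pi (T v) (T (~~ v)).
Proof. by case: v => //; exact: reversal_sym. Qed.

Let hold (v : bool) (x : X) : R := 1 - kmass (T v) x - rho v x.

Let hold_ge0 v x : 0 <= hold v x.
Proof. by rewrite /hold; have := hrho_hi x v; lra. Qed.

Let hold_le1 v x : `|hold v x| <= 1.
Proof.
rewrite ger0_norm// /hold; have := hrho_ge0 x v; have := kmass_ge0 (T v) x; lra.
Qed.

Let rho_le1 v x : `|rho v x| <= 1.
Proof.
rewrite ger0_norm//; have := hrho_hi x v; have := kmass_ge0 (T v) x; lra.
Qed.

Let kmass_norm_le1 v x : `|kmass (T v) x| <= 1.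
Proof. by rewrite ger0_norm ?kmass_ge0// kmass_le1. Qed.

Let measurable_hold v : measurable_fun setT (hold v).
Proof.
by apply: measurable_funB => //; apply: measurable_funB => //; exact: measurable_kmass.
Qed.

Definition lifted_square_integrable h := forall v, L2 (side h v).

Definition lifted_inner h k := mu_int pi (fun z => h z * k z).

Lemma lifted_innerE h k : lifted_inner h k =
  2^-1 * (inner pi (side h true) (side k true) + inner pi (side h false) (side k false)).
Proof. by []. Qed.

Lemma side_lifted h v : side (L h) v = fun x =>
  kint (T v) (side h v) x + side h v x * hold v x + side h (~~ v) x * rho v x.
Proof. by []. Qed.

Lemma lifted_closed h : lifted_square_integrable h -> lifted_square_integrable (L h).
Proof.
move=> ih v; rewrite side_lifted; apply: square_integrableD.
  apply: square_integrableD; first exact: square_integrable_kint (Trev v) _ (ih v).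
  exact: square_integrableMb.
exact: square_integrableMb.
Qed.

Lemma inner_side_lifted h w v : lifted_square_integrable h -> L2 w ->
  inner pi (side (L h) v) w = inner pi (kint (T v) (side h v)) w +
    inner pi (fun x => side h v x * hold v x) w +
    inner pi (fun x => side h (~~ v) x * rho v x) w.
Proof.
move=> ih iw; rewrite side_lifted.
have ik := square_integrable_kint _ _ _ (Trev v) _ (ih v).
have ihold : L2 (fun x => side h v x * hold v x) by exact: square_integrableMb.
have irho : L2 (fun x => side h (~~ v) x * rho v x) by exact: square_integrableMb.
rewrite -!innerD//; exact: square_integrableD.
Qed.

Lemma inner_mulC (c : X -> R) u w :
  inner pi (fun x => u x * c x) w = inner pi (fun x => w x * c x) u.
Proof. by apply: eq_Rintegral => x _; ring. Qed.

Lemma inner_side_lifted_linear (a : R) h k w v : lifted_square_integrable h ->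
  lifted_square_integrable k -> L2 w ->
  inner pi (side (L (fun z => a * h z + k z)) v) w =
  a * inner pi (side (L h) v) w + inner pi (side (L k) v) w.
Proof.
move=> ih ik iw.
have ihk : lifted_square_integrable (fun z => a * h z + k z).
  by move=> b; apply: square_integrableMD.
rewrite !inner_side_lifted// (inner_kintMD _ _ _ (Trev v))//.
have mulE (c : X -> R) b : measurable_fun setT c -> (forall x, `|c x| <= 1) ->
    inner pi (fun x => (a * h (x, b) + k (x, b)) * c x) w =
    a * inner pi (fun x => h (x, b) * c x) w + inner pi (fun x => k (x, b) * c x) w.
  move=> mc c1; have iwc : L2 (fun x => w x * c x) by exact: square_integrableMb.
  by rewrite inner_mulC innerC innerMD// ![inner _ _ (fun x => w x * _)]innerC
    ![inner _ (fun x => w x * _) _]inner_mulC.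
rewrite (mulE (hold v) v)// (mulE (rho v) (~~ v))//; ring.
Qed.

(** Jensen's inequality for the lifted kernel at [(x, v)], whose three parts have total mass one.
    The variance about the mean [c = L h (x, v)] is the [T v] part plus the two atoms
    [hold v * (h (x, v) - c)^2] and [rho v * (h (x, ~~ v) - c)^2]. *)
Lemma ae_side_lifted_sqr h v : lifted_square_integrable h ->
  {ae pi, forall x, L h (x, v) ^+ 2 <= kint (T v) (fun y => h (y, v) ^+ 2) x +
    h (x, v) ^+ 2 * hold v x + h (x, ~~ v) ^+ 2 * rho v x}.
Proof.
move=> ih.
apply: filterS (ae_kint_variance _ _ _ (Trev v) _ (side (L h) v) (ih v)) => x.
have -> : side (L h) v x = kint (T v) (side h v) x + h (x, v) * hold v x +
  h (x, ~~ v) * rho v x by [].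
have := hold_ge0 v x; have := hrho_ge0 x v.
have : hold v x = 1 - kmass (T v) x - rho v x by [].
move: (kint _ (fun y => _ ^+ 2) x) (kint (T v) _ x) (kmass _ x) => t2 t m.
move: (hold v x) (rho v x) (h (x, v)) (h (x, ~~ v)) => al r a b.
move=> alE r0 al0; set c := t + a * al + b * r.
have tE : t = c - a * al - b * r by rewrite /c; ring.
have mE : m = 1 - al - r by lra.
move: c tE => c ->; rewrite mE => var.
have := mulr_ge0 al0 (sqr_ge0 (a - c)); have := mulr_ge0 r0 (sqr_ge0 (b - c)); nra.
Qed.

(** Jensen's inequality is integrated on each side, where reversal turns [T v] acting on a square
    into the weight [kmass (T (~~ v))]. After summing over [v], the weights on [h (x, v)^2] are
    [kmass (T (~~ v))], [hold v] and [rho (~~ v)], which add up to one by [hrho_diff]. *)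
Lemma lifted_contraction h : lifted_square_integrable h ->
  lifted_inner (L h) (L h) <= lifted_inner h h.
Proof.
move=> ih.
have sideh v : inner pi (side (L h) v) (side (L h) v) <=
    inner pi (fun x => side h v x * kmass (T (~~ v)) x) (side h v) +
    inner pi (fun x => side h v x * hold v x) (side h v) +
    inner pi (fun x => side h (~~ v) x * rho v x) (side h (~~ v)).
  have kE := pi_int_kint_sqr _ _ _ (Trev v) _ (ih v).
  have ik := integrable_kint_sqr _ _ _ (Trev v) _ (ih v).
  have mulI (c : X -> R) b : measurable_fun setT c -> (forall x, `|c x| <= 1) ->
      pi.-integrable setT (fun x => (h (x, b) * c x * h (x, b))%:E).
    by move=> mc c1; apply: square_integrable_mul => //; exact: square_integrableMb.
  have i1 := mulI (hold v) v (measurable_hold v) (hold_le1 v).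
  have i2 := mulI (rho v) (~~ v) (hrho_meas v) (rho_le1 v).
  rewrite -kE /inner /pi_int -!RintegralD//; last exact: (integrableD measurableT ik i1).
  have iL := lifted_closed _ ih v.
  have i3 := square_integrable_mul _ _ _ iL iL.
  have i4 := integrableD measurableT (integrableD measurableT ik i1) i2.
  apply: fine_le; [exact: integrable_fin_num|exact: integrable_fin_num|].
  apply: ae_ge0_le_integral => //.
  - by move=> x _; rewrite lee_fin -expr2 sqr_ge0.
  - exact: measurable_int i3.
  - move=> x _; rewrite lee_fin !addr_ge0//.
    + by apply: Rintegral_ge0 => y _; exact: sqr_ge0.
    + by rewrite mulrAC -expr2 mulr_ge0// sqr_ge0.
    + by rewrite mulrAC -expr2 mulr_ge0// sqr_ge0.
  - exact: measurable_int i4.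
  apply: filterS (ae_side_lifted_sqr _ v ih) => x hx _.
  by rewrite lee_fin -expr2 (le_trans hx)// !(mulrAC _ _ (h _)) -!expr2.
have sumE v : inner pi (side h v) (side h v) =
    inner pi (fun x => side h v x * kmass (T (~~ v)) x) (side h v) +
    inner pi (fun x => side h v x * hold v x) (side h v) +
    inner pi (fun x => side h v x * rho (~~ v) x) (side h v).
  have ikm : L2 (fun x => side h v x * kmass (T (~~ v)) x).
    by apply: square_integrableMb => //; exact: measurable_kmass.
  have ihold : L2 (fun x => side h v x * hold v x) by exact: square_integrableMb.
  have irho : L2 (fun x => side h v x * rho (~~ v) x) by exact: square_integrableMb.
  rewrite -!innerD//; last exact: square_integrableD.
  congr inner; apply/funext => x; rewrite -!mulrDr -[LHS]mulr1; congr (_ * _).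
  by have := hrho_diff x v; rewrite /hold; lra.
rewrite !lifted_innerE ler_wpM2l//; have /= := sideh true; have /= := sideh false.
by rewrite (sumE true) (sumE false)/=; lra.
Qed.

(** [P] transported to functions on [X * bool], so that it shares a space and a form with [L]. It is
    applied to functions of [x] alone, for which both slices coincide. *)
Definition lifted_base (h : X * bool -> R) (z : X * bool) : R :=
  P_op T1 Tm1 (fun x => h (x, true)) z.1.

(** A flip of [v] is invisible to a function of [x] alone: the two [rho] terms of [L] cancel. *)
Lemma P_opE u : P_op T1 Tm1 u = fun x =>
  2^-1 * L (fun z => u z.1) (x, true) + 2^-1 * L (fun z => u z.1) (x, false).
Proof. by apply/funext => x; rewrite /P_op /Plift_op/=; field. Qed.

Lemma lifted_square_integrable_fst u : L2 u ->
  lifted_square_integrable (fun z => u z.1).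
Proof. by move=> iu v. Qed.

Lemma lifted_inner_fst u w : lifted_inner (fun z => u z.1) (fun z => w z.1) =
  inner pi u w.
Proof. by rewrite lifted_innerE/=; lra. Qed.

Lemma square_integrable_P_op u : L2 u -> L2 (P_op T1 Tm1 u).
Proof.
move=> iu; have iL := lifted_closed _ (lifted_square_integrable_fst _ iu).
by rewrite P_opE; apply: square_integrableD; apply: square_integrableZ; exact: iL.
Qed.

Lemma inner_P_op u w : L2 u -> L2 w -> inner pi (P_op T1 Tm1 u) w =
  lifted_inner (L (fun z => u z.1)) (fun z => w z.1).
Proof.
move=> iu iw; have iL := lifted_closed _ (lifted_square_integrable_fst _ iu).
have iZ v := square_integrableZ _ 2^-1 _ (iL v).
by rewrite lifted_innerE P_opE innerD// !innerZ// mulrDr.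
Qed.

(** [P u] is the average of [L u] over [v], that is, its orthogonal projection onto functions of [x]
    alone, so its norm is at most that of [L u]. The auxiliary [sq] expands the squared distance
    from each side to this projection. *)
Lemma P_op_contraction u : L2 u ->
  inner pi (P_op T1 Tm1 u) (P_op T1 Tm1 u) <= inner pi u u.
Proof.
move=> iu; have iP := square_integrable_P_op _ iu.
have ih := lifted_square_integrable_fst _ iu; have iL := lifted_closed _ ih.
have := lifted_contraction _ ih; rewrite lifted_inner_fst; apply: le_trans.
move: (inner_P_op _ _ iu iP); rewrite !lifted_innerE/=.
set a := side (L _) true; set b := side (L _) false; set p := P_op T1 Tm1 u => pE.
have sq w : L2 w -> 0 <= inner pi w w - 2 * inner pi w p + inner pi p p.
  move=> iw; have := inner_ge0 pi (fun x => -1 * p x + w x).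
  have ipw := square_integrableMD _ (-1) _ _ iP iw.
  rewrite innerMD// ![inner _ _ (fun x => -1 * _ + _)]innerC !innerMD//.
  by rewrite [inner _ p w]innerC; lra.
have := sq _ (iL true); have := sq _ (iL false).
by rewrite -/a -/b; lra.
Qed.

(** The relation [L + L' = 2 P] on functions of [x] alone, with [L'] the adjoint. [tE] moves the
    three parts of [L] onto [u], where the flip part lands on the opposite side; [sE] is the
    resulting identity side by side. *)
Lemma lifted_adjoint u k : L2 u -> lifted_square_integrable k ->
  lifted_inner (fun z => u z.1) (L k) =
  2 * lifted_inner (fun z => P_op T1 Tm1 u z.1) k - lifted_inner (L (fun z => u z.1)) k.
Proof.
move=> iu ik; have iP := square_integrable_P_op _ iu.
have ih := lifted_square_integrable_fst _ iu; have iL := lifted_closed _ ih.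
have tE v : inner pi u (side (L k) v) =
    inner pi (fun x => kint (T (~~ v)) u x + u x * hold v x) (side k v) +
    inner pi (fun x => u x * rho v x) (side k (~~ v)).
  have ikt := square_integrable_kint _ _ _ (Trev (~~ v)) _ iu.
  have ihold : L2 (fun x => u x * hold v x) by exact: square_integrableMb.
  rewrite innerC inner_side_lifted// innerD// (inner_kint _ _ _ (Trev v))//.
  by rewrite [inner _ (side k v) _]innerC !(inner_mulC _ _ u).
have sE v : 2 * inner pi (P_op T1 Tm1 u) (side k v) =
    inner pi (side (L (fun z => u z.1)) v) (side k v) +
    inner pi (fun x => kint (T (~~ v)) u x + u x * hold v x) (side k v) +
    inner pi (fun x => u x * rho (~~ v) x) (side k v).
  have ikt := square_integrable_kint _ _ _ (Trev (~~ v)) _ iu.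
  have ihold : L2 (fun x => u x * hold v x) by exact: square_integrableMb.
  have irho : L2 (fun x => u x * rho (~~ v) x) by exact: square_integrableMb.
  have isum := square_integrableD _ _ _ ikt ihold.
  have iall := square_integrableD _ _ _ (square_integrableD _ _ _ (iL v) isum) irho.
  rewrite -!innerD//; last exact: square_integrableD.
  have := innerMD _ 1 _ _ _ iP iP (ik v); rewrite mul1r => e.
  rewrite mulr_natl mulr2n -e; congr inner; apply/funext => x.
  (* The pointwise balance is [hold v x + rho (~~ v) x = 1 - kmass (T (~~ v)) x]. *)
  have := hrho_diff x v; rewrite /P_op /Plift_op /hold /=.
  by case: v {isum iall ikt ihold irho e} => /= ?; nra.
have t1 := tE true; have t0 := tE false; have s1 := sE true; have s0 := sE false.
rewrite !lifted_innerE; move: t1 t0 s1 s0 => /=; lra.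
Qed.

End lifted.

(** * Comparison of [var_lambda] for the two chains *)

Theorem theorem3p17 (d : measure_display) (X : measurableType d) (R : realType)
  (pi : probability X R) (T1 Tm1 : R.-spker X ~> X)
  (hrev : forall A B : set X, measurable A -> measurable B ->
     (\int[pi]_(x in A) T1 x B = \int[pi]_(y in B) Tm1 y A)%E)
  (rho : bool -> X -> R)
  (hrho_meas : forall v, measurable_fun setT (rho v))
  (hrho_diff : forall x v, rho v x - rho (~~ v) x
                 = kmass (Tsel T1 Tm1 (~~ v)) x - kmass (Tsel T1 Tm1 v) x)
  (hrho_lo : forall x v,
     Num.max 0 (kmass (Tsel T1 Tm1 (~~ v)) x - kmass (Tsel T1 Tm1 v) x) <= rho v x)
  (hrho_hi : forall x v, rho v x <= 1 - kmass (Tsel T1 Tm1 v) x)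
  (lam : R) (hlam0 : 0 <= lam) (hlam1 : lam < 1)
  (f : X -> R) (hfm : measurable_fun setT f)
  (hf2 : pi.-integrable setT (fun x => (f x ^+ 2)%:E)) :
  var_lambda (mu_int pi) (Plift_op T1 Tm1 rho) lam (fun xv => f xv.1)
  <= var_lambda (pi_int pi) (P_op T1 Tm1) lam f.
Proof.
have rev : reversal pi T1 Tm1 by exact: hrev.
have hrho_ge0 x v : 0 <= rho v x.
  by have := hrho_lo x v; rewrite ge_max => /andP[].
have if2 : square_integrable pi f by split.
pose fb x := f x - pi_int pi f.
have ifb : square_integrable pi fb.
  have := square_integrableMD pi 1 _ _ if2 (square_integrable_cst pi (- pi_int pi f)).
  by under [X in square_integrable pi X -> _]eq_fun do rewrite mul1r.
(* The first marginal of [mu] is [pi], so both variances centre [f] by the same constant. *)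
have mean : mu_int pi (fun xv => f xv.1) = pi_int pi f by rewrite /mu_int /pi_int/=; lra.
rewrite /var_lambda mean.
pose F (z : X * bool) := fb z.1.
pose P := lifted_base T1 Tm1.
have iterP k : iter k P F = fun z => iter k (P_op T1 Tm1) fb z.1.
  by elim: k => //= k ->.
have -> : mu_int pi (fun xv => (f xv.1 - pi_int pi f) ^+ 2) =
    pi_int pi (fun x => (f x - pi_int pi f) ^+ 2).
  by rewrite /mu_int /pi_int/=; lra.
rewrite lerD2l ler_wpM2l//.
(* The autocovariances under [pi] are rewritten on the lifted space, so that both series use the
   same form and the same vector [F]. *)
have -> : (fun n => \sum_(1 <= k < n) lam ^+ k * pi_int pi (fun x =>
      (f x - pi_int pi f) * iter k (P_op T1 Tm1) (fun x => f x - pi_int pi f) x)) =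
    (fun n => \sum_(1 <= k < n) lam ^+ k * lifted_inner pi F (iter k P F)).
  apply/funext => n; apply: eq_bigr => k _; congr (_ * _).
  by rewrite iterP lifted_inner_fst.
have adj := lifted_adjoint _ _ _ _ rev hrho_meas hrho_diff hrho_ge0 hrho_hi.
have lin := inner_side_lifted_linear _ _ _ _ rev hrho_meas hrho_ge0 hrho_hi.
have Lclosed := lifted_closed _ _ _ _ rev hrho_meas hrho_ge0 hrho_hi.
have iP := square_integrable_P_op _ _ _ _ rev hrho_meas hrho_ge0 hrho_hi.
have innerP := inner_P_op _ _ _ _ rev hrho_meas hrho_ge0 hrho_hi.
pose S := lifted_square_integrable pi.
have Slin (a : R) x y : S x -> S y -> S (a *: x + y).
  by move=> ix iy v; exact: (square_integrableMD pi a _ _ (ix v) (iy v)).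
pose Sx (h : X * bool -> R) := exists2 u, square_integrable pi u & h = (fun z => u z.1).
apply: (@neumann_comparison R (X * bool -> R) S (lifted_inner pi) _ Slin _ _ _
  lam (Plift_op T1 Tm1 rho) P Sx F hlam0 hlam1).
- by move=> v; exact: square_integrable0.
- move=> a x y z ix iy iz; rewrite !lifted_innerE.
  have e v := innerMD pi a _ _ _ (ix v) (iy v) (iz v).
  by rewrite (e true) (e false) /=; ring.
- by move=> x y; rewrite !lifted_innerE ![inner _ (fun _ => x _) _]innerC.
- by move=> x _; rewrite lifted_innerE mulr_ge0// addr_ge0// inner_ge0.
- exact: Lclosed.
- move=> a x y z ix iy iz; rewrite !lifted_innerE.
  have e v := lin a _ _ _ v ix iy (iz v).
  by rewrite (e true) (e false) /=; ring.
- exact: lifted_contraction rev hrho_meas hrho_diff hrho_ge0 hrho_hi.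
- by move=> _ [u iu ->] v.
- by exists (fun=> 0) => //; exact: square_integrable0.
- move=> a _ _ [u iu ->] [w iw ->].
  by exists (fun x => a * u x + w x) => //; exact: square_integrableMD.
- by move=> _ [u iu ->]; exists (P_op T1 Tm1 u) => //; exact: iP.
- move=> a _ _ z [u iu ->] [w iw ->] iz; rewrite !lifted_innerE.
  have e v : inner pi (P_op T1 Tm1 (fun x => a * u x + w x)) (fun x => z (x, v)) =
      a * inner pi (P_op T1 Tm1 u) (fun x => z (x, v)) +
      inner pi (P_op T1 Tm1 w) (fun x => z (x, v)).
    have iuw := square_integrableMD pi a _ _ iu iw.
    (* Linearity of [P] against one slice of [z] is inherited from [L], tested against that slice
       extended constantly in [v]. *)
    rewrite !innerP// !lifted_innerE.
    have l b := lin a (fun z => u z.1) (fun z => w z.1) _ b (fun=> iu) (fun=> iw) (iz v).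
    by rewrite (l true) (l false); ring.
  by rewrite (e true) (e false); ring.
- move=> _ [u iu ->]; rewrite !lifted_inner_fst.
  exact: P_op_contraction rev hrho_meas hrho_diff hrho_ge0 hrho_hi _ iu.
- by move=> _ g [u iu ->] ig; exact: adj.
- by exists fb.
Qed.
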